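(* Let $m,n$ be relatively prime positive integers and let $\ell$ be an integer with $0<\ell<mn$. The triangular $(q,t)$-Schröder polynomial specializes at $a=0$ to the triangular $(q,t)$-Catalan polynomial: $$S_{m,n,\ell}(q,t,0)=\sum_{\pi\in \mathrm{D}(m,n,\ell)}q^{\mathrm{area}(\pi)}t^{\mathrm{dinv}(\pi)}=:C_{m,n,\ell}(q,t).$$
   Context: A box is identified with its northeast corner $(x,y)\in\mathbb{Z}_{\ge1}^2$, and a partition $\lambda=(\lambda_1\ge\lambda_2\ge\dots)$ with the set of boxes $\{(x,y): y\ge 1,\ 1\le x\le\lambda_y\}$. For coprime positive integers $m,n$ and an integer $0<\ell<mn$, let $\tau_{m,n,\ell}=\{(x,y)\in\mathbb{Z}_{\ge1}^2: nx+my\le \ell\}$. $\mathrm{D}(m,n,\ell)$ is the set of pairs $\pi=(\lambda,\tau_{m,n,\ell})$ with $\lambda\subset\tau_{m,n,\ell}$ a partition (possibly empty). $\mathrm{area}(\pi)=|\tau_{m,n,\ell}|-|\lambda|$. $\mathrm{dinv}(\pi)$ is the number of boxes $\Box\in\lambda$ with $\frac{\mathrm{leg}(\Box)}{\mathrm{arm}(\Box)+1}<\frac nm\le\frac{\mathrm{leg}(\Box)+1}{\mathrm{arm}(\Box)}$, where $\mathrm{leg}(\Box)$ (resp. $\mathrm{arm}(\Box)$) is the number of boxes of $\lambda$ strictly above $\Box$ in its column (resp. strictly to the right of $\Box$ in its row), and the right-hand fraction is $+\infty$ if $\mathrm{arm}(\Box)=0$. Triangular Schröder polynomial. Let $\Gamma_{m,n}=\{nx+my: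 x,y\in\mathbb{Z}_{\ge0}\}$. $\mathrm{Inv}_{m,n}$ is the set of $\Delta\subset\mathbb{Z}_{\ge0}$ with $\Delta+m\subset\Delta$ and $\Delta+n\subset\Delta$. For such $\Delta$ put $\overline\Delta=\mathbb{Z}_{\ge0}\setminus\Delta$, $n\text{-}\mathrm{gen}(\Delta)=\{k\in\Delta:k-n\notin\Delta\}$, $\mathrm{cogen}_{\ge0}(\Delta)=\{k\in\mathbb{Z}_{\ge0}\setminus\Delta: k+n\in\Delta,\ k+m\in\Delta\}$, $\xi_k(\Delta)=|\{x\in n\text{-}\mathrm{gen}(\Delta): n+k+1\le x\le n+k+m\}|$ for $k\in\mathbb{Z}$, $\mathrm{area}'(\Delta)=|\overline\Delta\cap\mathbb{Z}_{\ge n+m}|$, and $$\mathrm{codinv}'(\Delta)=\sum_{x\in n\text{-}\mathrm{gen}(\Delta)}|\overline\Delta\cap\mathbb{Z}_{\ge n+m}\cap[x,x+m-1]|-\binom{\xi_{-1}(\Delta)}{2}.$$ Let $\mathbf{w}(m,n,\ell)=(w_0,\dots,w_{m+n-1})\in\{0,1\}^{m+n}$ with $w_i=1$ iff $i+mn-\ell-(n+m)\in\Gamma_{m,n}$, and let $\mathrm{Inv}_{\mathbf{w}(m,n,\ell)}$ be the set of $\Delta\in\mathrm{Inv}_{m,n}$ such that for $0\le i\le m+n-1$: $i\in\Delta$ iff $w_i=1$. The triangular Schröder polynomial is $$S_{m,n,\ell}(q,t,a)=t^{|\tau_{m,n,\ell}|}\sum_{\Delta\in\mathrm{Inv}_{\mathbf{w}(m,n,\ell)}}q^{\mathrm{area}'(\Delta)}t^{-\mathrm{codinv}'(\Delta)}\prod_{k\in\mathrm{cogen}_{\ge0}(\Delta)}\bigl(1+at^{-\xi_k(\Delta)}\bigr).$$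 *)

(* Defs.v *)
From mathcomp Require Import all_boot all_order all_algebra fraction.
From mathcomp Require Import finmap.
From mathcomp Require Import mathcomp_extra boolp classical_sets functions.
From mathcomp Require Import cardinality fsbigop.

Set Implicit Arguments.
Unset Strict Implicit.
Unset Printing Implicit Defensive.

Import Order.TTheory GRing.Theory Num.Theory.

Local Open Scope classical_set_scope.
Local Open Scope ring_scope.

(* [fset_set A], like the finitely supported big operators [\big_(_ \in A)],
   takes a default value when [A] is infinite.  All the sets counted or summed
   over below are finite as soon as [m], [n] are positive and coprime,
   [0 < l < m * n] and [D] is a member of [InvW m n (wvec m n l)]. *)
Definition ncard (T : choiceType) (A : set T) : nat := #|` fset_set A|%fset.

(* Z[q, t] with inner variable q and outer variable t; its fraction field
   contains the Laurent polynomials in which negative powers of t live. *)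
Definition Zqt := {poly {poly int}}.
Definition Qqt := {fraction Zqt}.
Definition qv : Zqt := 'X%:P.
Definition tv : Zqt := 'X.

Definition is_partition (s : seq nat) : bool := sorted geq s && (0%N \notin s).

(* A box is its northeast corner (x, y), so coordinates start at 1, whereas
   [nth] counts from 0. *)
Definition boxes (s : seq nat) : set (nat * nat) :=
  [set b | (1 <= b.2)%N /\ (1 <= b.1 <= nth 0%N s b.2.-1)%N].

Definition tau (m n l : nat) : set (nat * nat) :=
  [set b | [/\ (1 <= b.1)%N, (1 <= b.2)%N & (n * b.1 + m * b.2 <= l)%N]].

Definition leg (s : seq nat) (b : nat * nat) : nat :=
  ncard [set c | [/\ boxes s c, c.1 = b.1 & (b.2 < c.2)%N]].

Definition arm (s : seq nat) (b : nat * nat) : nat :=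
  ncard [set c | [/\ boxes s c, c.2 = b.2 & (b.1 < c.1)%N]].

Definition Dset (m n l : nat) : set (seq nat * set (nat * nat)) :=
  [set p | [/\ is_partition p.1, p.2 = tau m n l & boxes p.1 `<=` p.2]].

(* No truncation occurs for [p] in [Dset m n l], where [boxes p.1 `<=` p.2]. *)
Definition area (p : seq nat * set (nat * nat)) : nat :=
  (ncard p.2 - ncard (boxes p.1))%N.

Definition dinv_box (m n : nat) (s : seq nat) (b : nat * nat) : bool :=
  let a := arm s b in let g := leg s b in
  (g%:R / a.+1%:R < n%:R / m%:R :> rat) &&
  ((a == 0%N) || (n%:R / m%:R <= g.+1%:R / a%:R :> rat)).

Definition dinv (m n : nat) (p : seq nat * set (nat * nat)) : nat :=
  ncard [set b | boxes p.1 b /\ dinv_box m n p.1 b].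

Definition catalan (m n l : nat) : Zqt :=
  \sum_(p \in Dset m n l) (qv ^+ area p * tv ^+ dinv m n p).

Definition Gamma (m n : nat) : set int :=
  [set z | exists x y : nat, z = (n * x + m * y)%N%:Z].

(* Subsets of the nonnegative integers are sets of [int], so that [k - n] in
   [ngen] is a genuine difference: every k < n in [D] is a generator. *)
Definition Inv (m n : nat) : set (set int) :=
  [set D | [/\ forall k, D k -> 0 <= k,
               forall k, D k -> D (k + m%:Z)
             & forall k, D k -> D (k + n%:Z)]].

Definition gaps (D : set int) : set int := [set k | 0 <= k /\ ~ D k].

Definition ngen (n : nat) (D : set int) : set int :=
  [set k | D k /\ ~ D (k - n%:Z)].

Definition cogen (m n : nat) (D : set int) : set int :=
  [set k | [/\ gaps D k, D (k + n%:Z) & D (k + m%:Z)]].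

Definition xi (m n : nat) (D : set int) (k : int) : nat :=
  ncard [set x | ngen n D x /\ n%:Z + k + 1 <= x <= n%:Z + k + m%:Z].

Definition area' (m n : nat) (D : set int) : nat :=
  ncard [set k | gaps D k /\ (n + m)%N%:Z <= k].

Definition codinv' (m n : nat) (D : set int) : int :=
  \sum_(x \in ngen n D)
     (ncard [set k | [/\ gaps D k, (n + m)%N%:Z <= k
                       & x <= k <= x + m%:Z - 1]])%:Z
  - 'C(xi m n D (-1), 2)%:Z.

Definition wvec (m n l : nat) : (m + n).-tuple bool :=
  [tuple `[< Gamma m n ((i : nat)%:Z + (m * n)%N%:Z - l%:Z - (n + m)%N%:Z) >]
     | i < m + n].

Definition InvW (m n : nat) (w : (m + n).-tuple bool) : set (set int) :=
  [set D | Inv m n D /\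
           forall i : 'I_(m + n), D (i : nat)%:Z <-> tnth w i = true].

(* A polynomial in the variable a (here ['X]) over Q(q, t). *)
Definition schroder (m n l : nat) : {poly Qqt} :=
  (tofrac tv ^+ ncard (tau m n l)) *:
  \sum_(D \in InvW (wvec m n l))
     ((tofrac qv ^+ area' m n D * tofrac tv ^ (- codinv' m n D)) *:
      \big[*%R/1]_(k \in cogen m n D) (1 + tofrac tv ^ (- (xi m n D k)%:Z) *: 'X)).

(* Main.v *)
Require Import Defs.
From mathcomp Require Import all_boot all_order all_algebra fraction.
From mathcomp Require Import finmap boolp classical_sets functions.
From mathcomp Require Import cardinality fsbigop zify.

(** Put the label l + n + m - n x - m y on the lattice point (x, y).  Since m
    and n are coprime, every integer is the label of exactly one point with
    1 <= y <= n.  For a partition inside the triangle tau, the nonnegative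
    labels of the points on or to the left of its boundary form an invariant
    subset [delta s].  The labels in the window [0, n + m - 1] belong to it
    exactly when x <= 0, whatever the partition is, which is the condition
    expressed by [wvec]; the labels of the boxes of tau are all >= n + m and
    they distinguish the partitions.  So [delta] is a bijection onto the index
    set of the Schroeder sum ([delta_inj], [delta_surj]), and the gaps >= n + m
    of [delta s] are the labels of the boxes of tau outside the partition
    ([gapP]): this gives the exponent of q.  At a = 0 the product over the
    cogenerators is 1.

    It remains to see that codinv' + dinv = |tau|.  Let g_y be the label of the
    end of row y and c_x the label of the top of column x ([row_gen],
    [col_gen]).  The g_y that are >= n are the n-generators >= n.  One lying in
    [n, n + m - 1] comes from an empty row, and the labels of the points
    (0, y) are m apart; so there is at most one, the binomial in codinv'
    vanishes, and codinv' counts the pairs (y, b) of a row and a box b of tau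
    outside the partition with g_y <= label b < g_y + m.  On the other hand a
    box (x, y) of the partition counts for dinv iff g_y - n < c_x <= g_y + m
    ([dinv_boxE]).

    Walk along the boundary path from (0, n) towards the x-axis.  A step down
    along the end of row y raises the label from g_y to g_y + m, a step right
    along the top of column x lowers it from c_x + n to c_x.  Hence codinv'
    counts the upward crossings of the levels label b.  Those in rows that reach
    the column of b correspond to the boxes (x_b, y) whose arm is too long, i.e.
    with c_x > g_y + m ([arm_heavy_count]).  The other ones occur before the
    path passes under b; on that part it goes from below the level to above it,
    so that they outnumber the downward crossings by exactly one
    ([rows_above_column]).  These downward crossings correspond in turn to the
    boxes (x, y_b) whose leg is too long, i.e. with c_x <= g_y - n
    ([leg_heavy_count]).  Summing over b, codinv' is the number of boxes of tau
    outside the partition plus the number of boxes of the partition that do not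
    count for dinv ([balanced_card]). *)

Set Implicit Arguments.
Unset Strict Implicit.
Unset Printing Implicit Defensive.
Import Order.TTheory GRing.Theory Num.Theory.
Local Open Scope classical_set_scope.
Local Open Scope ring_scope.

(** * Labels of lattice points *)

(** The offset makes the line n x + m y = l, on which tau ends, carry the label
    n + m, the first one beyond the prescribed window. *)
Definition label (m n l : nat) (x y : int) : int :=
  (l + n + m)%:Z - n%:Z * x - m%:Z * y.

(** Row y carries one residue class modulo n, and by coprimality the rows
    1, ..., n exhaust the classes. *)
Lemma label_surj (m n l : nat) (k : int) : (0 < n)%N -> coprime m n ->
  exists2 y : nat, (0 < y <= n)%N & exists x : int, k = label m n l x y.
Proof.
move=> n_gt0 mn_coprime; have [u [v uv]] := Bezoutz m n.
have {}uv : u * m%:Z + v * n%:Z = 1.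
  by rewrite uv /gcdz /=; have := mn_coprime; rewrite /coprime => /eqP ->.
pose d := (l + n + m)%:Z - k.
have nZ_gt0 : (0 : int) < n%:Z by lia.
pose r := modz (u * d - 1) n%:Z.
have r_bound : 0 <= r < n%:Z.
  by rewrite /r modz_ge0 ?ltz_pmod //; lia.
have r_eq : u * d - 1 = divz (u * d - 1) n%:Z * n%:Z + r by exact: divz_eq.
exists (absz (r + 1)); first lia.
exists (v * d + m%:Z * divz (u * d - 1) n%:Z).
rewrite /label.
have -> : (absz (r + 1))%:Z = r + 1 by lia.
move: r_eq; set q := divz _ _ => r_eq.
have -> : r + 1 = u * d - q * n%:Z by rewrite -[u * d](subrK 1) r_eq; lia.
have : u * m%:Z * d + v * n%:Z * d = d by rewrite -mulrDl uv mul1r.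
rewrite /d; lia.
Qed.

Lemma label_inj (m n l : nat) (x x' : int) (y y' : nat) :
  (0 < n)%N -> coprime m n -> (0 < y <= n)%N -> (0 < y' <= n)%N ->
  label m n l x y = label m n l x' y' -> x = x' /\ y = y'.
Proof.
move=> n_gt0 mn_coprime y_in y'_in; rewrite /label => eq_label.
have eq_mul : n%:Z * (x - x') = m%:Z * (y'%:Z - y%:Z) by lia.
have : (n%:Z %| m%:Z * (y'%:Z - y%:Z))%Z by rewrite -eq_mul dvdz_mulr.
rewrite Gauss_dvdzr; last by rewrite coprimezE /= coprime_sym.
case/dvdzP => q q_eq.
have q0 : q = 0 by nia.
have yy' : y = y' by move: q_eq; rewrite q0; lia.
split=> //; move: eq_mul; rewrite yy' subrr mulr0 => /eqP.
by rewrite mulf_eq0; lia.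
Qed.

(** * Crossings of the boundary path of a partition *)

(** A step of the boundary path between the labels v and v + d crosses the
    level K when v <= K < v + d; a label is above the level when it is > K. *)
Definition crosses (K v : int) (d : nat) : bool := v <= K < v + d%:Z.

Lemma sum_nat_eq1 (P : pred nat) (a b c : nat) :
  (a <= c < b)%N -> P c -> (forall i, (a <= i < b)%N -> P i -> i = c) ->
  (\sum_(a <= i < b) P i = 1)%N.
Proof.
move=> cab Pc Puniq; rewrite (big_cat_nat (n := c)) /=; [|lia|lia].
rewrite big_nat big1; last first.
  by move=> i ib; case Pi: (P i) => //; have := Puniq i _ Pi; lia.
rewrite big_ltn ?Pc; last lia.
rewrite big_nat big1; first by [].
by move=> i ib; case Pi: (P i) => //; have := Puniq i _ Pi; lia.
Qed.

Lemma sum_nat_eq0 (P : pred nat) (a b : nat) :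
  (forall i, (a <= i < b)%N -> ~~ P i) -> (\sum_(a <= i < b) P i = 0)%N.
Proof. by move=> nP; rewrite big_nat big1 // => i /nP /negbTE ->. Qed.

Section BoundaryPath.
Variables (m n l : nat) (f h : nat -> nat).
Hypotheses (m_gt0 : (0 < m)%N) (l_lt_mn : (l < m * n)%N).
(* A partition enters only through its row lengths f and column lengths h: the
   box (x, y) is in it iff x <= f y, iff y <= h x. *)
Hypothesis conj_fh : forall x y : nat, (0 < x)%N -> (0 < y)%N ->
  (x <= f y)%N = (y <= h x)%N.
Hypothesis fits : forall x y : nat, (0 < x)%N -> (0 < y)%N -> (x <= f y)%N ->
  (n * x + m * y <= l)%N.

Definition row_gen (y : nat) : int := label m n l (f y) y.
Definition col_gen (x : nat) : int := label m n l x (h x).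

Lemma col_bound x : (0 < x)%N -> (h x <= n)%N.
Proof.
move=> x_gt0; case: (posnP (h x)) => [-> //|hx_gt0].
have := fits x_gt0 hx_gt0; rewrite conj_fh // leqnn => /(_ isT) le_l.
rewrite -(leq_pmul2l m_gt0); lia.
Qed.

Lemma col_antitone x : (0 < x)%N -> (h x.+1 <= h x)%N.
Proof.
move=> x_gt0; case: (posnP (h x.+1)) => [-> //|hx_gt0].
by rewrite -conj_fh // ltnW // conj_fh.
Qed.

(** Going down a column raises the label, so each level is crossed at most
    once. *)
Lemma column_crossings (K : int) (x a b : nat) : (a <= b)%N ->
  (\sum_(a.+1 <= y < b.+1) crosses K (label m n l x y) m
    + (K < label m n l x b)%R
   = (K < label m n l x a)%R)%N.
Proof.
move=> /subnK <-; elim: (b - a)%N => [|d IHd]; first by rewrite add0n big_geq.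
rewrite addSn big_nat_recr /=; last lia.
by rewrite -IHd /crosses /label; lia.
Qed.

(** Upward minus downward crossings of a level along the boundary path from
    (0, n) to (X, h X.+1).  The path starts at label l + n + m - m n < n + m,
    below the level, so the difference only depends on whether it ends above. *)
Lemma boundary_crossings (K : int) (X : nat) : (n + m)%:Z <= K ->
  (\sum_((h X.+1).+1 <= y < n.+1) crosses K (row_gen y) m
   = (K < label m n l X (h X.+1))%R +
     \sum_(1 <= x < X.+1) crosses K (col_gen x) n)%N.
Proof.
move=> K_ge; elim: X => [|X IHX].
  rewrite [in RHS]big_geq // addn0 -(column_crossings K 0 (col_bound _)) //.
  have -> : (K < label m n l 0%N n) = false by rewrite /label; lia.
  rewrite addn0 !big_nat; apply: eq_bigr => y /andP[y_gt _].
  suff -> : row_gen y = label m n l 0%N y by [].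
  by rewrite /row_gen; have := @conj_fh 1 y; case: (f y) => //; lia.
rewrite (big_cat_nat (n := (h X.+1).+1)) /=; last 2 first.
- by rewrite ltnS col_antitone.
- by rewrite ltnS col_bound.
rewrite IHX [in RHS]big_nat_recr //=.
rewrite -(column_crossings K X.+1 (col_antitone (ltn0Sn X))).
have -> : (\sum_((h X.+2).+1 <= y < (h X.+1).+1)
     crosses K (row_gen y) m =
   \sum_((h X.+2).+1 <= y < (h X.+1).+1)
     crosses K (label m n l X.+1 y) m)%N.
  rewrite !big_nat; apply: eq_bigr => y /andP[y_gt y_lt].
  suff fy : f y = X.+1 by rewrite /row_gen fy.
  have := @conj_fh X.+1 y; have := @conj_fh X.+2 y; lia.
rewrite /crosses /col_gen /label; lia.
Qed.

Definition in_tau (x y : nat) : bool := (n * x + m * y <= l)%N.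
Definition in_skew (x y : nat) : bool := in_tau x y && ~~ (x <= f y)%N.

Hypothesis n_gt0 : (0 < n)%N.

(** For a box b = (X, Y) outside the partition, the path stops at
    (X - 1, h X), below and to the left of b, hence with a larger label: this is
    the extra crossing, which accounts for b itself. *)
Lemma rows_above_column X Y : (0 < X)%N -> (0 < Y)%N -> in_skew X Y ->
  (\sum_((h X).+1 <= y < n.+1)
     crosses (label m n l X Y) (row_gen y) m
   = 1 + \sum_(1 <= x < X) crosses (label m n l X Y) (col_gen x) n)%N.
Proof.
case: X => // X _ Y_gt0 /andP[XY_tau]; rewrite conj_fh // => Y_gt.
rewrite boundary_crossings; last by move: XY_tau; rewrite /in_tau /label; lia.
congr (_ + _)%N; rewrite /label.
have : (m * h X.+1 <= m * Y)%N by rewrite leq_pmul2l //; lia.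
lia.
Qed.

(** Row Y has exactly one point with label in [c_x, c_x + n); it lies to the
    right of the partition iff c_x + n <= g_Y. *)
Lemma leg_heavy_count x Y : (0 < x)%N -> (0 < Y)%N ->
  (\sum_(1 <= X < m.+1)
     [&& in_skew X Y, (x < X)%N & crosses (label m n l X Y) (col_gen x) n]
   = (x <= f Y)%N && (col_gen x + n%:Z <= row_gen Y)%R)%N.
Proof.
move=> x_gt0 Y_gt0.
case: (boolP ((x <= f Y)%N && (col_gen x + n%:Z <= row_gen Y))).
- move=> /andP[xfY le_cg].
  have Y_le : (Y <= h x)%N by rewrite -conj_fh.
  have c_ge : (n + m)%:Z <= col_gen x.
    have h_gt0 : (0 < h x)%N by lia.
    have := fits x_gt0 h_gt0; rewrite conj_fh // leqnn => /(_ isT).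
    by rewrite /col_gen /label; lia.
  (* X0 is the largest X with c_x <= label (X, Y). *)
  pose d : nat := `|label m n l 0 Y - col_gen x|%N.
  have dE : d%:Z = label m n l 0 Y - col_gen x.
    by move: le_cg; rewrite /d /row_gen /label; lia.
  have dn : (n * (d %/ n) <= d < n * (d %/ n) + n)%N.
    by rewrite mulnC leq_trunc_div /= -mulSnr ltn_ceil.
  set X0 := (d %/ n)%N in dn.
  have X0_label : col_gen x <= label m n l X0 Y < col_gen x + n%:Z.
    by move: dE; rewrite /label; lia.
  have X0_gt : (f Y < X0)%N.
    rewrite -(ltn_pmul2l n_gt0); move: X0_label le_cg; rewrite /row_gen /label.
    lia.
  have X0_tau : in_tau X0 Y by move: X0_label; rewrite /in_tau /label; lia.
  apply: (@sum_nat_eq1 _ _ _ X0).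
  + have : (n * X0 < n * m)%N by move: X0_tau; rewrite /in_tau; lia.
    rewrite ltn_pmul2l //; lia.
  + by rewrite /in_skew /crosses X0_tau X0_label -ltnNge X0_gt /=; lia.
  + move=> X _ /and3P[_ _ X_label].
    move: X_label X0_label; rewrite /crosses /label.
    move=> ? ?; have : (n * X < n * X0 + n)%N by lia.
    have : (n * X0 < n * X + n)%N by lia.
    by rewrite -!mulnSr !ltn_pmul2l //; lia.
- move=> not_heavy; apply: sum_nat_eq0 => X /andP[X_gt0 _]; apply/negP.
  case/and3P=> /andP[_ X_la] x_lt /andP[c_le _].
  move: not_heavy; have [xfY /=|fYx _] := leqP x (f Y).
    apply/negP/negPn; move: X_la; rewrite -ltnNge => fYX.
    have : (n * (f Y).+1 <= n * X)%N by rewrite leq_pmul2l.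
    rewrite mulnS; move: c_le; rewrite /row_gen /label; lia.
  have hxY : (h x < Y)%N by rewrite ltnNge -conj_fh // -ltnNge.
  have : (m * h x <= m * Y)%N by rewrite leq_pmul2l // ltnW.
  have : (n * x.+1 <= n * X)%N by rewrite leq_pmul2l.
  rewrite mulnS; move: c_le; rewrite /col_gen /label; lia.
Qed.

Hypothesis mn_coprime : coprime m n.

(** Column X has exactly one point with label in [g_y, g_y + m); it lies above
    the partition iff c_X > g_y + m.  The borderline c_X = g_y + m would need
    m to divide the arm, which is less than m, so it cannot occur. *)
Lemma arm_heavy_count X y : (0 < X)%N -> (0 < y)%N -> (X <= f y)%N ->
  (\sum_(1 <= Y < n.+1)
     (in_skew X Y && crosses (label m n l X Y) (row_gen y) m)
   = (row_gen y + m%:Z < col_gen X)%R)%N.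
Proof.
move=> X_gt0 y_gt0 Xfy.
have g_ge : (n + m)%:Z <= row_gen y.
  have f_gt0 : (0 < f y)%N by lia.
  by have := fits f_gt0 y_gt0 (leqnn _); rewrite /row_gen /label; lia.
case: ltP => [lt_gc|le_cg].
(* Y0 is the largest Y with g_y <= label (X, Y). *)
- pose d : nat := `|label m n l X 0 - row_gen y|%N.
  have dE : d%:Z = label m n l X 0 - row_gen y.
    by move: lt_gc; rewrite /d /col_gen /label; lia.
  have dm : (m * (d %/ m) <= d < m * (d %/ m) + m)%N.
    by rewrite mulnC leq_trunc_div /= -mulSnr ltn_ceil.
  set Y0 := (d %/ m)%N in dm.
  have Y0_label : row_gen y <= label m n l X Y0 < row_gen y + m%:Z.
    by move: dE; rewrite /label; lia.
  have Y0_gt : (h X < Y0)%N.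
    rewrite -(ltn_pmul2l m_gt0); move: Y0_label lt_gc; rewrite /col_gen /label.
    lia.
  have Y0_tau : in_tau X Y0 by move: Y0_label; rewrite /in_tau /label; lia.
  apply: (@sum_nat_eq1 _ _ _ Y0).
  + have : (m * Y0 < m * n)%N by move: Y0_tau; rewrite /in_tau; lia.
    rewrite ltn_pmul2l //; lia.
  + rewrite /in_skew /crosses Y0_tau Y0_label conj_fh //; lia.
  + move=> Y _ /andP[_ Y_label].
    move: Y_label Y0_label; rewrite /crosses /label.
    move=> ? ?; have : (m * Y < m * Y0 + m)%N by lia.
    have : (m * Y0 < m * Y + m)%N by lia.
    by rewrite -!mulnSr !ltn_pmul2l //; lia.
- apply: sum_nat_eq0 => Y /andP[Y_gt0 _]; apply/negP.
  case/andP=> /andP[_ Y_la] /andP[g_le _].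
  have Y_gt : (h X < Y)%N by rewrite ltnNge -conj_fh.
  have : (m * (h X).+1 <= m * Y)%N by rewrite leq_pmul2l.
  rewrite mulnS => mY_ge.
  have same : (n * X + m * Y = n * f y + m * y)%N.
    by move: le_cg g_le; rewrite /col_gen /row_gen /label; lia.
  have : (n * X <= n * f y)%N by rewrite leq_pmul2l.
  move=> nX_le; have : (m %| n * (f y - X))%N.
    apply/dvdnP; exists (Y - y)%N; rewrite mulnBr mulnBl; lia.
  rewrite Gauss_dvdr // => m_dvd.
  have f_lt : (f y - X < m)%N.
    have f_gt0 : (0 < f y)%N by lia.
    suff : (n * f y < n * m)%N by rewrite ltn_pmul2l //; lia.
    have := fits f_gt0 y_gt0 (leqnn _); lia.
  have Xf : X = f y.
    have [|pos] := posnP (f y - X)%N; first lia.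
    by have := dvdn_leq pos m_dvd; lia.
  have Yy : Y = y.
    apply/eqP; rewrite -(eqn_pmul2l m_gt0); move: same; rewrite Xf; lia.
  by move: Y_la; rewrite Yy Xf leqnn.
Qed.

(** The first sum counts the upward crossings and is codinv'; the second one
    is dinv. *)
Lemma balanced_card :
  (\sum_(1 <= y < n.+1) \sum_(1 <= X < m.+1) \sum_(1 <= Y < n.+1)
      (in_skew X Y && crosses (label m n l X Y) (row_gen y) m)
   + \sum_(1 <= X < m.+1) \sum_(1 <= Y < n.+1)
      ((X <= f Y)%N && (row_gen Y < col_gen X + n%:Z)%R &&
        (col_gen X <= row_gen Y + m%:Z)%R)
   = \sum_(1 <= X < m.+1) \sum_(1 <= Y < n.+1) in_tau X Y)%N.
Proof.
pose up (X Y y : nat) := crosses (label m n l X Y) (row_gen y) m.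
pose down (X Y x : nat) := crosses (label m n l X Y) (col_gen x) n.
have low_rows : (\sum_(1 <= X < m.+1) \sum_(1 <= y < n.+1)
    ((X <= f y) && (row_gen y + m%:Z < col_gen X)%R) =
  \sum_(1 <= X < m.+1) \sum_(1 <= Y < n.+1) \sum_(1 <= y < n.+1)
    [&& in_skew X Y, X <= f y & up X Y y])%N.
  rewrite big_nat [RHS]big_nat; apply: eq_bigr => X /andP[X_gt0 _].
  rewrite [RHS]exchange_big /= big_nat [RHS]big_nat; apply: eq_bigr.
  move=> y /andP[y_gt0 _]; case: (boolP (X <= f y)%N) => [Xfy|_] /=.
    by rewrite -arm_heavy_count.
  by rewrite big1 // => Y _; rewrite andbF.
have left_cols : (\sum_(1 <= x < m.+1) \sum_(1 <= Y < n.+1)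
    ((x <= f Y) && (col_gen x + n%:Z <= row_gen Y)%R) =
  \sum_(1 <= X < m.+1) \sum_(1 <= Y < n.+1) \sum_(1 <= x < m.+1)
    [&& in_skew X Y, x < X & down X Y x])%N.
  rewrite exchange_big [RHS]exchange_big /= big_nat [RHS]big_nat.
  apply: eq_bigr => Y /andP[Y_gt0 _].
  rewrite [RHS]exchange_big /= big_nat [RHS]big_nat.
  by apply: eq_bigr => x /andP[x_gt0 _]; rewrite leg_heavy_count.
have upE : (\sum_(1 <= y < n.+1) \sum_(1 <= X < m.+1) \sum_(1 <= Y < n.+1)
      (in_skew X Y && up X Y y) =
  \sum_(1 <= X < m.+1) \sum_(1 <= Y < n.+1) (in_skew X Y +
    (\sum_(1 <= y < n.+1) [&& in_skew X Y, X <= f y & up X Y y] +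
     \sum_(1 <= x < m.+1) [&& in_skew X Y, x < X & down X Y x])))%N.
  rewrite exchange_big /= big_nat [RHS]big_nat; apply: eq_bigr.
  move=> X /andP[X_gt0 X_le]; rewrite exchange_big /= big_nat [RHS]big_nat.
  apply: eq_bigr => Y /andP[Y_gt0 Y_le].
  case: (boolP (in_skew X Y)) => [XY_skew /=|_]; last by rewrite !big1.
  have hX_le := col_bound X_gt0.
  rewrite (big_cat_nat (n := (h X).+1)) //=.
  rewrite [X in (_ = 1 + (X + _))%N](big_cat_nat (n := (h X).+1)) //=.
  rewrite [X in (_ = 1 + (_ + X))%N](big_cat_nat (n := X)) //=;
    last exact: ltnW.
  rewrite rows_above_column //.
  have -> : (\sum_((h X).+1 <= y < n.+1) ((X <= f y) && up X Y y) = 0)%N.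
    apply: sum_nat_eq0 => y /andP[y_gt _]; rewrite conj_fh //; last lia.
    by rewrite leqNgt y_gt.
  have -> : (\sum_(X <= x < m.+1) ((x < X) && down X Y x) = 0)%N.
    by apply: sum_nat_eq0 => x /andP[x_ge _]; rewrite ltnNge x_ge.
  have -> : (\sum_(1 <= y < (h X).+1) ((X <= f y) && up X Y y) =
             \sum_(1 <= y < (h X).+1) up X Y y)%N.
    rewrite big_nat [RHS]big_nat; apply: eq_bigr => y /andP[y_gt0 y_le].
    by rewrite conj_fh // -ltnS y_le.
  have -> : (\sum_(1 <= x < X) ((x < X) && down X Y x) =
             \sum_(1 <= x < X) down X Y x)%N.
    by rewrite big_nat [RHS]big_nat; apply: eq_bigr => x /andP[_ ->].
  by rewrite !addn0 addnCA.
(* Each box of tau is now counted once: outside the partition by in_skew,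
   inside it by exactly one of the dinv condition and its two failures. *)
rewrite upE; under eq_bigr => X _ do rewrite big_split /= big_split /=.
rewrite big_split /= big_split /= -low_rows -left_cols -!big_split /=.
rewrite big_nat [RHS]big_nat; apply: eq_bigr => X /andP[X_gt0 _].
rewrite -!big_split big_nat [RHS]big_nat; apply: eq_bigr => Y /andP[Y_gt0 _] /=.
rewrite /in_skew; have := @fits X Y X_gt0 Y_gt0; rewrite -/(in_tau X Y).
case: (X <= f Y)%N => [/(_ isT) ->|_] /=; last by rewrite andbT !addn0.
by lia.
Qed.

End BoundaryPath.

(** * Partitions as pairs of row and column lengths *)

Definition row_len (s : seq nat) (y : nat) : nat := nth 0%N s y.-1.
Definition col_len (s : seq nat) (x : nat) : nat := count (leq x) s.

Lemma geq_trans : transitive geq.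
Proof. by move=> y x z; rewrite /geq /= => yx zy; apply: leq_trans zy yx. Qed.

Lemma row_len_col_len s (x y : nat) : sorted geq s -> (0 < x)%N -> (0 < y)%N ->
  (x <= row_len s y)%N = (y <= col_len s x)%N.
Proof.
rewrite /row_len /col_len; move=> + x_gt0; case: y => // y + _ /=.
elim: s y => [|a s IHs] y /=; first by rewrite nth_nil; case: x x_gt0.
move=> as_sorted; have s_sorted := path_sorted as_sorted.
have /allP a_max := order_path_min geq_trans as_sorted.
have [xa|ax] := leqP x a.
  by case: y => [|y] /=; [rewrite xa|rewrite IHs].
have -> : count (leq x) s = 0%N.
  apply/eqP; rewrite -leqn0 leqNgt -has_count; apply/hasPn => b /a_max /=; lia.
case: y => [|y] /=; first by rewrite leqNgt ax.
rewrite ltn0; have [y_lt|y_ge] := ltnP y (size s).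
  by have := a_max _ (mem_nth 0%N y_lt); rewrite /=; lia.
by rewrite nth_default //; lia.
Qed.

Lemma row_len_antitone s (y z : nat) : sorted geq s -> (0 < y <= z)%N ->
  (row_len s z <= row_len s y)%N.
Proof.
move=> s_sorted yz; case: (posnP (row_len s z)) => [-> //|pos].
rewrite row_len_col_len //; last lia.
by apply: leq_trans (_ : z <= _)%N; [lia|rewrite -row_len_col_len //; lia].
Qed.

Lemma row_len_inj (s s' : seq nat) : is_partition s -> is_partition s' ->
  (forall y, (0 < y)%N -> row_len s y = row_len s' y) -> s = s'.
Proof.
move=> /andP[_ s0] /andP[_ s'0] rowE.
have nthE i : nth 0%N s i = nth 0%N s' i by apply: (rowE i.+1).
have le_size (u v : seq nat) : 0%N \notin u ->
    (forall i, nth 0%N u i = nth 0%N v i) -> (size u <= size v)%N.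
  move=> u0 uv; rewrite leqNgt; apply/negP => v_lt.
  by move: u0; rewrite -(nth_default 0%N (leqnn (size v))) -uv mem_nth.
by apply: (@eq_from_nth _ 0%N) => //; apply/eqP; rewrite eqn_leq !le_size.
Qed.

Lemma partition_of_rows (f : nat -> nat) (N : nat) :
  (forall y, (0 < y)%N -> (f y.+1 <= f y)%N) ->
  (forall y, (N < y)%N -> f y = 0%N) ->
  exists2 s, is_partition s & forall y, (0 < y)%N -> row_len s y = f y.
Proof.
move=> f_anti f0.
have f0_ex : exists p, f p.+1 == 0%N by exists N; rewrite f0.
case: (ex_minnP f0_ex) => p /eqP fp p_min.
have f_pos i : (i < p)%N -> (0 < f i.+1)%N.
  by move=> ip; rewrite lt0n; apply/negP => /p_min; lia.
have f_tail i : (p <= i)%N -> f i.+1 = 0%N.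
  move=> /subnKC <-; elim: (i - p)%N => [|d IHd]; first by rewrite addn0.
  by have := f_anti (p + d).+1; rewrite addnS IHd //; lia.
exists (mkseq (fun i => f i.+1) p).
- apply/andP; split.
    apply/(sortedP 0%N) => i; rewrite size_mkseq => ip.
    by rewrite !nth_mkseq //; [apply: f_anti|lia].
  apply/negP => /(nthP 0%N)[i]; rewrite size_mkseq => ip.
  by rewrite nth_mkseq // => f_eq0; have := f_pos _ ip; rewrite f_eq0.
- case=> // y _; rewrite /row_len /=; have [yp|py] := ltnP y p.
    by rewrite nth_mkseq.
  by rewrite nth_default ?size_mkseq // f_tail.
Qed.

(** Used to read off the row lengths of a partition from a subset closed under
    adding n. *)
Lemma downset_threshold (P : pred nat) (M : nat) :
  (forall x, (0 < x)%N -> P x.+1 -> P x) -> (forall x, (M < x)%N -> ~~ P x) ->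
  exists t, forall x, (0 < x)%N -> P x = (x <= t)%N.
Proof.
move=> P_down P_fin.
have ex_fail : exists t, ~~ P t.+1 by exists M; apply: P_fin.
case: (ex_minnP ex_fail) => t t_fail t_min; exists t => -[//|x] _.
apply/idP/idP => [|x_lt]; last first.
  by apply/negPn/negP => /t_min; rewrite leqNgt x_lt.
apply: contraTT; rewrite -ltnNge ltnS => /subnKC <-.
elim: (x - t)%N => [|d IHd]; first by rewrite addn0.
by apply: contra IHd; rewrite addnS; apply: P_down.
Qed.

(** * Counting boxes *)

Lemma ncardE (T : choiceType) (A : set T) (r : seq T) : uniq r ->
  (forall x, A x <-> x \in r) -> ncard A = size r.
Proof.
move=> r_uniq A_r; have -> : A = [set` [fset x in r]%fset].
  by apply/seteqP; split => x /=; rewrite inE => /A_r.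
by rewrite /ncard set_fsetK card_fseq undup_id.
Qed.

Lemma ncard_count (T : choiceType) (A : set T) (r : seq T) : uniq r ->
  (forall x, A x -> x \in r) -> ncard A = count (fun x => `[< A x >]) r.
Proof.
move=> r_uniq A_r; rewrite -size_filter; apply: ncardE => [|x].
  exact: filter_uniq.
rewrite mem_filter; split=> [Ax|/andP[/asboolP]//].
by rewrite A_r // andbT; apply/asboolP.
Qed.

Definition grid (m n : nat) : seq (nat * nat) :=
  [seq (x, y) | x <- index_iota 1 m.+1, y <- index_iota 1 n.+1].

Lemma grid_uniq m n : uniq (grid m n).
Proof. by rewrite allpairs_uniq ?iota_uniq // => -[? ?] [? ?]. Qed.

Lemma mem_grid m n x y :
  ((x, y) \in grid m n) = (0 < x <= m)%N && (0 < y <= n)%N.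
Proof.
apply/allpairsP/idP => [[[a b] /= [+ + [-> ->]]]|xy_in].
  by rewrite !mem_index_iota !ltnS => -> ->.
by exists (x, y); rewrite !mem_index_iota !ltnS; move: xy_in => /andP[-> ->].
Qed.

Lemma count_grid m n (P : pred (nat * nat)) :
  count P (grid m n) =
  (\sum_(1 <= x < m.+1) \sum_(1 <= y < n.+1) P (x, y))%N.
Proof.
rewrite -sum1_count big_mkcond /= big_allpairs_dep /=.
by apply: eq_bigr => x _; apply: eq_bigr => y _; case: (P _).
Qed.

Lemma ncard_le1 (T : choiceType) (A : set T) :
  (forall x y, A x -> A y -> x = y) -> (ncard A <= 1)%N.
Proof.
move=> A_le1; have [[x Ax]|A0] := pselect (exists x, A x).
  rewrite (@ncardE _ _ [:: x]) // => y; rewrite inE.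
  by split=> [/(A_le1 _ _ Ax) ->|/eqP ->].
by rewrite (@ncardE _ _ [::]) // => y; split=> // Ay; case: A0; exists y.
Qed.

Lemma arm_row_len s x y : (0 < x)%N -> (0 < y)%N ->
  arm s (x, y) = (row_len s y - x)%N.
Proof.
move=> x_gt0 y_gt0; rewrite /arm.
rewrite (@ncardE _ _ [seq (i, y) | i <- index_iota x.+1 (row_len s y).+1]).
- by rewrite size_map size_iota; lia.
- by rewrite map_inj_uniq ?iota_uniq // => ? ? [].
- move=> [a b] /=; split=> [[[/= _ /andP[_ a_le]] bE xa]|/mapP[i]].
    by rewrite bE in a_le *; rewrite map_f // mem_index_iota ltnS xa.
  rewrite mem_index_iota /row_len => i_in [-> ->].
  by split=> //=; [split=> //=|]; lia.
Qed.

Lemma leg_col_len s x y : sorted geq s -> (0 < x)%N -> (0 < y)%N ->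
  leg s (x, y) = (col_len s x - y)%N.
Proof.
move=> s_sorted x_gt0 y_gt0; rewrite /leg.
rewrite (@ncardE _ _ [seq (x, i) | i <- index_iota y.+1 (col_len s x).+1]).
- by rewrite size_map size_iota; lia.
- by rewrite map_inj_uniq ?iota_uniq // => ? ? [].
- move=> [a b] /=; split=> [[[/= b_gt0 /andP[_ a_le]] aE yb]|/mapP[i]].
    rewrite aE in a_le *; rewrite map_f // mem_index_iota yb ltnS.
    by rewrite -row_len_col_len.
  rewrite mem_index_iota ltnS => /andP[y_lt i_le] [-> ->].
  split=> //; split=> /=; first lia.
  rewrite -/(row_len s i) row_len_col_len //; lia.
Qed.

(** * Partitions in the triangle and invariant subsets *)

Section InvariantSubsets.
Variables m n l : nat.
Hypotheses (m_gt0 : (0 < m)%N) (n_gt0 : (0 < n)%N).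
Hypotheses (mn_coprime : coprime m n) (l_lt_mn : (l < m * n)%N).

(** The abscissa x may be negative: the elements of [delta s] with x <= 0 are
    the part of the subset common to all partitions. *)
Definition delta (s : seq nat) : set int :=
  [set k | 0 <= k /\ exists (y : nat) (x : int),
     [/\ (0 < y <= n)%N, x <= (row_len s y)%:Z & k = label m n l x y]].

Lemma delta_label s (x : int) (y : nat) : (0 < y <= n)%N ->
  0 <= label m n l x y -> delta s (label m n l x y) <-> x <= (row_len s y)%:Z.
Proof.
move=> y_in label_ge0; split=> [[_ [y' [x' [y'_in x'_le eq_label]]]]|x_le].
  by have [-> ->] := label_inj n_gt0 mn_coprime y_in y'_in eq_label.
by split=> //; exists y, x.
Qed.

(** The shift turns the label of (x, y) into n (- x) + m (n - y), in which the
    coefficient n - y of m is the least possible one as y is in 1, ..., n. *)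
Lemma Gamma_label (x : int) (y : nat) : (0 < y <= n)%N ->
  Gamma m n (label m n l x y + (m * n)%N%:Z - l%:Z - (n + m)%N%:Z) <-> x <= 0.
Proof.
move=> y_in; split=> [[x' [y' eq_label]]|x_le0].
- rewrite leNgt; apply/negP => x_gt0.
  have eq_mul : n%:Z * (x'%:Z + x) = m%:Z * (n%:Z - y%:Z - y'%:Z).
    by move: eq_label; rewrite /label; lia.
  have : (n%:Z %| m%:Z * (n%:Z - y%:Z - y'%:Z))%Z by rewrite -eq_mul dvdz_mulr.
  rewrite Gauss_dvdzr; last by rewrite coprimezE /= coprime_sym.
  case/dvdzP => q q_eq; have q_le0 : q <= 0 by nia.
  have : m%:Z * (n%:Z - y%:Z - y'%:Z) <= 0.
    by rewrite q_eq mulr_ge0_le0 ?mulr_le0_ge0.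
  by rewrite -eq_mul leNgt mulr_gt0 //; lia.
- exists `|x|%N, (n - y)%N; rewrite /label.
  have -> : (m * n)%N = (m * (n - y) + m * y)%N.
    by rewrite -mulnDr; congr muln; lia.
  have : n%:Z * (absz x)%:Z = - (n%:Z * x).
    by rewrite -mulrN; congr (_ * _); lia.
  lia.
Qed.

Lemma wvecE (i : 'I_(m + n)) : tnth (wvec m n l) i = true <->
  Gamma m n ((i : nat)%:Z + (m * n)%N%:Z - l%:Z - (n + m)%N%:Z).
Proof. by rewrite tnth_mktuple; split=> /asboolP. Qed.

(** Steps of -n towards x = 0, and then of -m along the y-axis, stay among the
    points with x <= 0 and 1 <= y <= n until the window is reached, where the
    membership is prescribed. *)
Lemma InvW_Gamma D : InvW (wvec m n l) D -> forall (x : int) (y : nat),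
  (0 < y <= n)%N -> 0 <= label m n l x y -> x <= 0 -> D (label m n l x y).
Proof.
move=> [[_ D_addm D_addn] D_w].
suff main (d : nat) (x : int) (y : nat) : (0 < y <= n)%N ->
    d%:Z = label m n l x y -> x <= 0 -> D d%:Z.
  move=> x y y_in; case E: (label m n l x y) => [d|//] _ x_le0.
  exact: main y_in (esym E) x_le0.
elim/ltn_ind: d x y => d IHd x y y_in dE x_le0.
have [d_lt|d_ge] := ltnP d (m + n).
  by apply/(D_w (Ordinal d_lt))/wvecE; rewrite /= dE Gamma_label.
have [x_eq0|x_neq0] := eqVneq x 0.
  have y_lt : (y < n)%N.
    rewrite ltn_neqAle; case/andP: y_in => _ ->; rewrite andbT.
    by apply/eqP => yn; move: dE; rewrite /label x_eq0 yn; lia.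
  have -> : d%:Z = (d - m)%N%:Z + m%:Z by lia.
  apply/D_addm/(IHd _ _ x y.+1) => //; first lia.
  by move: dE; rewrite /label; lia.
have -> : d%:Z = (d - n)%N%:Z + n%:Z by lia.
apply/D_addn/(IHd _ _ (x + 1) y) => //; [lia| |lia].
by move: dE; rewrite /label; lia.
Qed.

Lemma in_tau_grid x y : (0 < x)%N -> (0 < y)%N -> in_tau m n l x y ->
  (x, y) \in grid m n.
Proof.
rewrite mem_grid /in_tau => -> -> /= xy_le; apply/andP; split.
  by rewrite -(leq_pmul2l n_gt0); lia.
by rewrite -(leq_pmul2l m_gt0); lia.
Qed.

Section Partition.
Variable s : seq nat.
Hypotheses (s_part : is_partition s) (s_tau : boxes s `<=` tau m n l).

Let s_sorted : sorted geq s. Proof. by case/andP: s_part. Qed.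

Lemma boxes_fit x y : (0 < x)%N -> (0 < y)%N -> (x <= row_len s y)%N ->
  (n * x + m * y <= l)%N.
Proof.
move=> x_gt0 y_gt0 x_le; have [] // : tau m n l (x, y).
by apply: s_tau; split=> //=; rewrite x_gt0.
Qed.

Lemma row_len_lt y : (0 < y)%N -> (row_len s y < m)%N.
Proof.
move=> y_gt0; case: (posnP (row_len s y)) => [-> //|pos].
by have := boxes_fit pos y_gt0 (leqnn _); rewrite -(ltn_pmul2l n_gt0); lia.
Qed.

(** Adding m moves one row down, where rows are longer.  From row 1 one lands
    on (x - m, n) instead, which is to the left of the y-axis because rows have
    length less than m. *)
Lemma delta_Inv : Defs.Inv m n (delta s).
Proof.
split=> [k [] //|k|k]; case=> [k_ge0 [y [x [y_in x_le kE]]]].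
- split; first lia.
  have [y_gt1|y_le1] := ltnP 1 y.
    exists y.-1, x; split; first lia; last by rewrite kE /label; lia.
    by apply: le_trans x_le _; rewrite lez_nat row_len_antitone //; lia.
  have y1 : y = 1%N by lia.
  exists n, (x - m%:Z); split; first lia; last by rewrite kE y1 /label; lia.
  by have := row_len_lt (ltn0Sn 0); rewrite y1 in x_le; lia.
- split; first lia.
  by exists y, (x - 1); split=> //; [lia|rewrite kE /label; lia].
Qed.

(** A point with 1 <= x on or to the left of the boundary is a box of tau, and
    its label is beyond the window. *)
Lemma delta_InvW : InvW (wvec m n l) (delta s).
Proof.
split; first exact: delta_Inv.
move=> i; rewrite wvecE.
have [y y_in [x iE]] := label_surj l (i : nat)%:Z n_gt0 mn_coprime.
rewrite iE Gamma_label // delta_label //; last by rewrite -iE.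
split=> [x_le|]; last by move=> ?; apply: le_trans (_ : 0 <= _).
rewrite leNgt; apply/negP => x_gt0.
have : (n * `|x|%N + m * y <= l)%N by apply: boxes_fit; lia.
have := ltn_ord i; move: iE; rewrite /label.
have -> : n%:Z * x = (n * `|x|%N)%N%:Z by rewrite PoszM; congr (_ * _); lia.
lia.
Qed.

Let s_conj := fun x y => @row_len_col_len s x y s_sorted.

Local Notation s_row_gen := (row_gen m n l (row_len s)).
Local Notation s_col_gen := (col_gen m n l (col_len s)).
Local Notation s_skew := (in_skew m n l (row_len s)).
Local Notation Delta := (delta s).

Lemma gapP k : gaps Delta k /\ (n + m)%N%:Z <= k <->
  exists x y : nat, [/\ (0 < x)%N, (0 < y)%N, s_skew x y & k = label m n l x y].
Proof.
split=> [[[k_ge0 k_gap] k_ge]|[x [y [x_gt0 y_gt0 /andP[xy_tau x_gt] ->]]]].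
  have [y y_in [x kE]] := label_surj l k n_gt0 mn_coprime.
  have x_gt : (row_len s y)%:Z < x.
    rewrite ltNge; apply/negP => x_le; apply: k_gap; rewrite kE.
    by apply/delta_label => //; rewrite -kE.
  exists (absz x), y; have xE : (absz x)%:Z = x by lia.
  split; [lia|lia| |by rewrite xE].
  rewrite /in_skew /in_tau; apply/andP; split; last lia.
  by move: k_ge; rewrite kE -xE /label; lia.
have k_ge : (n + m)%N%:Z <= label m n l x y.
  by move: xy_tau; rewrite /in_tau /label; lia.
have k_ge0 : 0 <= label m n l x y by apply: le_trans k_ge.
split=> //; split=> // /delta_label; rewrite lez_nat (negbTE x_gt).
have := in_tau_grid x_gt0 y_gt0 xy_tau; rewrite mem_grid => /andP[_ y_in].
by move=> xy; have := xy y_in k_ge0.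
Qed.

Lemma ncard_gaps (Q : pred int) :
  ncard [set k | [/\ gaps Delta k, (n + m)%N%:Z <= k & Q k]] =
  (\sum_(1 <= x < m.+1) \sum_(1 <= y < n.+1)
     (s_skew x y && Q (label m n l x y)))%N.
Proof.
pose P (b : nat * nat) := s_skew b.1 b.2 && Q (label m n l b.1 b.2).
rewrite (@ncardE _ _
  [seq label m n l b.1 b.2 | b : nat * nat <- grid m n & P b]).
- by rewrite size_map size_filter count_grid.
- rewrite map_inj_in_uniq ?filter_uniq ?grid_uniq // => -[x y] [x' y'].
  rewrite !mem_filter !mem_grid => /and3P[_ _ y_in] /and3P[_ _ y'_in] /=.
  by move=> /(label_inj n_gt0 mn_coprime y_in y'_in) [[->] ->].
- move=> k; split=> [[k_gap k_ge Qk]|/mapP[[x y]]].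
    have /gapP[x [y [x_gt0 y_gt0 xy_skew kE]]] := conj k_gap k_ge.
    rewrite kE; apply/mapP; exists (x, y) => //.
    rewrite mem_filter /P /= xy_skew -kE Qk in_tau_grid //.
    by case/andP: xy_skew.
  rewrite mem_filter mem_grid => /andP[/andP[/= xy_skew Qk]].
  move=> /andP[/andP[x_gt0 _] /andP[y_gt0 _]] ->.
  have [] : gaps Delta (label m n l x y) /\ (n + m)%N%:Z <= label m n l x y.
    by apply/gapP; exists x, y.
  by [].
Qed.

Lemma ngen_row (k : int) : n%:Z <= k -> ngen n Delta k ->
  exists2 y, (0 < y <= n)%N & k = s_row_gen y.
Proof.
move=> k_ge [[k_ge0 [y [x [y_in x_le kE]]]] k_sub].
exists y => //; rewrite kE /row_gen; congr label.
apply/eqP; rewrite eq_le x_le leNgt /=; apply/negP => x_lt; apply: k_sub.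
split; first lia.
by exists y, (x + 1); split=> //; [lia|rewrite kE /label; lia].
Qed.

Lemma row_ngen y : (0 < y <= n)%N -> n%:Z <= s_row_gen y ->
  ngen n Delta (s_row_gen y).
Proof.
move=> y_in g_ge; split; first by apply/delta_label => //; apply: le_trans g_ge.
have -> : s_row_gen y - n%:Z = label m n l ((row_len s y)%:Z + 1) y.
  by rewrite /row_gen /label; lia.
rewrite delta_label //; first lia.
by move: g_ge; rewrite /row_gen /label; lia.
Qed.

Lemma row_gen_inj : {in [pred y | (0 < y <= n)%N] &, injective s_row_gen}.
Proof.
by move=> y y' y_in y'_in /(label_inj n_gt0 mn_coprime y_in y'_in) [].
Qed.

(** A generator in [n, n + m - 1] ends an empty row, as a box of tau has a label
    >= n + m; so it is the label of a point of the y-axis. *)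
Lemma xi_le1 : (xi m n Delta (-1) <= 1)%N.
Proof.
apply: ncard_le1 => k k' [k_gen k_in] [k'_gen k'_in].
have low_gen j : ngen n Delta j ->
    n%:Z + -1 + 1 <= j <= n%:Z + -1 + m%:Z ->
    exists y : nat, j = (l + n + m)%N%:Z - m%:Z * y%:Z.
  move=> j_gen j_in; have [|y y_in jE] := ngen_row _ j_gen; first lia.
  exists y; rewrite jE /row_gen /label.
  suff -> : row_len s y = 0%N by lia.
  apply/eqP; rewrite -leqn0 leqNgt; apply/negP => row_gt0.
  have y_gt0 : (0 < y)%N by lia.
  have := boxes_fit row_gt0 y_gt0 (leqnn _).
  by move: j_in; rewrite jE /row_gen /label; lia.
have [y kE] := low_gen _ k_gen k_in; have [y' k'E] := low_gen _ k'_gen k'_in.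
suff -> : k = k' by [].
have lt1 : (m * y < m * y'.+1)%N by rewrite mulnSr; lia.
have lt2 : (m * y' < m * y.+1)%N by rewrite mulnSr; lia.
by rewrite !ltn_pmul2l // in lt1 lt2; rewrite kE k'E; congr (_ - _ * _); lia.
Qed.

(** Generators below n are irrelevant: the interval [x, x + m - 1] then misses
    the labels >= n + m.  So it does no harm that a row whose end has a negative
    label contains a generator different from that label. *)
Lemma codinv'_delta :
  codinv' m n Delta =
  (\sum_(1 <= y < n.+1) \sum_(1 <= X < m.+1) \sum_(1 <= Y < n.+1)
     (s_skew X Y && crosses (label m n l X Y) (s_row_gen y) m))%N%:Z.
Proof.
rewrite /codinv'.
have -> : 'C(xi m n Delta (-1), 2) = 0%N.
  by apply: bin_small; rewrite ltnS xi_le1.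
rewrite subr0.
pose c x := ncard [set k | [/\ gaps Delta k, (n + m)%N%:Z <= k
                             & x <= k <= x + m%:Z - 1]].
have c0 x : x < n%:Z -> c x = 0%N.
  move=> x_lt; rewrite /c (@ncardE _ _ [::]) // => k; split=> // -[_].
  by move=> k_ge k_in; exfalso; lia.
pose r := [seq s_row_gen y | y <- index_iota 1 n.+1 & n%:Z <= s_row_gen y].
have r_uniq : uniq r.
  rewrite map_inj_in_uniq ?filter_uniq ?iota_uniq // => y y'.
  rewrite !mem_filter !mem_index_iota !ltnS => /andP[_ y_in] /andP[_ y'_in].
  exact: row_gen_inj.
rewrite -(@fsbig_widen _ _ _ _ [set` r]); last 2 first.
- move=> x /= /mapP[y]; rewrite mem_filter mem_index_iota ltnS => /andP[? ?] ->.
  exact: row_ngen.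
- move=> x [/= x_gen x_r]; rewrite -/(c x) c0 // ltNge; apply/negP => x_ge.
  have [y y_in xE] := ngen_row x_ge x_gen.
  apply: x_r; rewrite xE; apply: map_f.
  by rewrite mem_filter mem_index_iota -xE x_ge ltnS.
rewrite -fsbig_seq // big_map big_filter big_mkcond /=.
rewrite (big_morph Posz PoszD (erefl _)); apply: eq_bigr => y _.
rewrite -/(c _); transitivity (c (s_row_gen y))%:Z.
  by case: leP => // /c0 ->.
rewrite /c (ncard_gaps (fun k => s_row_gen y <= k <= s_row_gen y + m%:Z - 1)).
congr Posz; apply: eq_bigr => X _; apply: eq_bigr => Y _.
by rewrite /crosses; congr (nat_of_bool (_ && _)); lia.
Qed.

Lemma dinv_boxE x y : (0 < x)%N -> (0 < y)%N -> (x <= row_len s y)%N ->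
  dinv_box m n s (x, y) =
  (s_row_gen y < s_col_gen x + n%:Z) && (s_col_gen x <= s_row_gen y + m%:Z).
Proof.
move=> x_gt0 y_gt0 x_le; have y_le := x_le; rewrite s_conj // in y_le.
rewrite /dinv_box arm_row_len // leg_col_len // /row_gen /col_gen /label.
set a := (_ - x)%N; set g := (_ - y)%N.
have -> : row_len s y = (x + a)%N by rewrite subnKC.
have -> : col_len s x = (y + g)%N by rewrite subnKC.
rewrite ltr_pdivrMr ?ltr0n // mulrAC ltr_pdivlMr ?ltr0n // -!natrM ltr_nat.
have -> : (a == 0%N) || (n%:R / m%:R <= g.+1%:R / a%:R :> rat) =
          (n * a <= m * g.+1)%N.
  case: posnP => [-> /=|a_gt0 /=]; first by rewrite muln0.
  rewrite ler_pdivrMr ?ltr0n // mulrAC ler_pdivlMr ?ltr0n // -!natrM ler_nat.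
  by rewrite (mulnC m).
by congr (_ && _); lia.
Qed.

Lemma ncard_tau : ncard (tau m n l) =
  (\sum_(1 <= x < m.+1) \sum_(1 <= y < n.+1) in_tau m n l x y)%N.
Proof.
rewrite (ncard_count (grid_uniq m n)) => [|[x y] []]; last exact: in_tau_grid.
rewrite count_grid big_nat [RHS]big_nat; apply: eq_bigr => x /andP[x_gt0 _].
rewrite big_nat [RHS]big_nat; apply: eq_bigr => y /andP[y_gt0 _].
by congr nat_of_bool; apply/asboolP/idP => [[]|xy_tau]; [|split].
Qed.

Lemma boxes_grid b : boxes s b -> b \in grid m n.
Proof. by case: b => x y /s_tau []; apply: in_tau_grid. Qed.

Lemma area_delta : area' m n Delta = area (s, tau m n l).
Proof.
have -> : area' m n Delta =
    (\sum_(1 <= x < m.+1) \sum_(1 <= y < n.+1) s_skew x y)%N.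
  rewrite /area'.
  have -> : [set k | gaps Delta k /\ (n + m)%N%:Z <= k] =
      [set k | [/\ gaps Delta k, (n + m)%N%:Z <= k & predT k]].
    by apply/seteqP; split => k /= [].
  rewrite ncard_gaps; apply: eq_bigr => x _; apply: eq_bigr => y _.
  by rewrite andbT.
rewrite /area ncard_tau (ncard_count (grid_uniq m n) boxes_grid) count_grid.
suff -> : (\sum_(1 <= x < m.+1) \sum_(1 <= y < n.+1) in_tau m n l x y =
   \sum_(1 <= x < m.+1) \sum_(1 <= y < n.+1) s_skew x y +
   \sum_(1 <= x < m.+1) \sum_(1 <= y < n.+1) `[< boxes s (x, y) >])%N.
  by rewrite addnK.
rewrite -big_split big_nat [RHS]big_nat; apply: eq_bigr => x /andP[x_gt0 _] /=.
rewrite -big_split big_nat [RHS]big_nat; apply: eq_bigr => y /andP[y_gt0 _] /=.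
have -> : `[< boxes s (x, y) >] = (x <= row_len s y)%N.
  by apply/asboolP/idP => [[_ /andP[_]]//|x_le]; split=> //=; rewrite x_gt0.
rewrite /in_skew /in_tau; have := boxes_fit x_gt0 y_gt0.
by case: (x <= row_len s y)%N => [/(_ isT) ->|_]; rewrite ?andbT ?addn0.
Qed.

Lemma codinv'_dinv :
  codinv' m n Delta + (dinv m n (s, tau m n l))%:Z = (ncard (tau m n l))%:Z.
Proof.
rewrite codinv'_delta ncard_tau -PoszD; congr Posz.
rewrite -(balanced_card m_gt0 l_lt_mn s_conj boxes_fit n_gt0
  mn_coprime).
congr (_ + _)%N; rewrite /dinv (ncard_count (grid_uniq m n)); last first.
  by move=> b [/boxes_grid].
rewrite count_grid big_nat [RHS]big_nat; apply: eq_bigr => x /andP[x_gt0 _].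
rewrite big_nat [RHS]big_nat; apply: eq_bigr => y /andP[y_gt0 _].
congr nat_of_bool; rewrite -andbA.
apply/asboolP/andP => /= [[[_ /andP[_ x_le]]]|[x_le]].
  by rewrite dinv_boxE.
by rewrite -dinv_boxE // => b_dinv; split=> //; split=> //=; rewrite x_gt0.
Qed.

End Partition.

Lemma delta_inj s s' : is_partition s -> boxes s `<=` tau m n l ->
  is_partition s' -> boxes s' `<=` tau m n l ->
  delta s = delta s' -> s = s'.
Proof.
have le_rows u v : boxes u `<=` tau m n l -> delta u = delta v ->
    forall y, (0 < y)%N -> (row_len u y <= row_len v y)%N.
  move=> u_tau uv y y_gt0; case: (posnP (row_len u y)) => [-> //|row_gt0].
  have fit := boxes_fit u_tau row_gt0 y_gt0 (leqnn _).
  have := in_tau_grid row_gt0 y_gt0 fit; rewrite mem_grid => /andP[_ y_in].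
  have k_ge0 : 0 <= label m n l (row_len u y) y by rewrite /label; lia.
  have := (delta_label v y_in k_ge0).1.
  by rewrite -uv lez_nat; apply; apply/delta_label.
move=> s_part s_tau s'_part s'_tau eq_delta; apply: row_len_inj => // y y_gt0.
by apply/eqP; rewrite eqn_leq !le_rows.
Qed.

(** The length of row y is the largest x such that (x, y) is a box of tau with
    label in D; closure under m makes these lengths decrease with y. *)
Lemma delta_surj D : InvW (wvec m n l) D ->
  exists s, [/\ is_partition s, boxes s `<=` tau m n l & delta s = D].
Proof.
move=> D_w; have [[D_ge0 D_addm D_addn] D_window] := D_w.
pose P (y x : nat) :=
  [&& (y <= n)%N, in_tau m n l x y & `[< D (label m n l x y) >]].
have P_down y x : (0 < x)%N -> P y x.+1 -> P y x.
  move=> _ /and3P[y_le xy_tau /asboolP Dx]; apply/and3P; split=> //.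
    by move: xy_tau; rewrite /in_tau; lia.
  apply/asboolP; have -> : label m n l x y = label m n l x.+1 y + n%:Z.
    by rewrite /label; lia.
  exact: D_addn.
have P_fin y x : (m < x)%N -> ~~ P y x.
  move=> mx; apply/negP => /and3P[_ + _]; rewrite /in_tau.
  have : (n * m < n * x)%N by rewrite ltn_pmul2l.
  by lia.
have [f fP] := choice (fun y => downset_threshold (P_down y) (P_fin y)).
have Pf y : (0 < f y)%N -> P y (f y) by move=> f_gt0; rewrite fP.
have f_anti y : (0 < y)%N -> (f y.+1 <= f y)%N.
  move=> y_gt0; case: (posnP (f y.+1)) => [-> //|f_gt0]; rewrite -fP //.
  have /and3P[y_le xy_tau /asboolP Dx] := Pf _ f_gt0; apply/and3P; split.
  - exact: ltnW.
  - by move: xy_tau; rewrite /in_tau; lia.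
  - apply/asboolP; have -> : label m n l (f y.+1) y =
      label m n l (f y.+1) y.+1 + m%:Z by rewrite /label; lia.
    exact: D_addm.
have f0 y : (n < y)%N -> f y = 0%N.
  move=> y_gt; apply/eqP; rewrite -leqn0 leqNgt; apply/negP => /Pf /and3P[].
  by rewrite leqNgt y_gt.
have [s s_part s_rows] := partition_of_rows f_anti f0.
exists s; split=> //.
  move=> [x y] [/= y_gt0 /andP[x_gt0]]; rewrite -/(row_len s y) s_rows //.
  by rewrite -fP // => /and3P[].
apply/seteqP; split=> [k [k_ge0 [y [x [y_in]]]]|k Dk].
  rewrite s_rows; last by case/andP: y_in.
  move=> x_le kE; rewrite kE in k_ge0 *.
  have [x_le0|x_gt0] := lerP x 0; first exact: InvW_Gamma.
  have xE : (absz x)%:Z = x by lia.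
  have : P y (absz x) by rewrite fP; lia.
  by case/and3P => _ _ /asboolP; rewrite xE.
have k_ge0 := D_ge0 _ Dk; split=> //.
have [y y_in [x kE]] := label_surj l k n_gt0 mn_coprime.
have y_gt0 : (0 < y)%N by case/andP: y_in.
exists y, x; split=> //; rewrite s_rows //.
have [x_le0|x_gt0] := lerP x 0; first exact: le_trans x_le0 _.
have xE : (absz x)%:Z = x by lia.
suff : P y (absz x) by rewrite fP; lia.
apply/and3P; rewrite xE -kE; split; [by case/andP: y_in| |exact/asboolP].
have [k_lt|k_ge] := ltnP (absz k) (m + n); last first.
  by move: kE; rewrite -xE /in_tau /label; lia.
have kabs : (absz k)%:Z = k by lia.
have := (D_window (Ordinal k_lt)).1; rewrite wvecE /= kabs => /(_ Dk).
by rewrite kE Gamma_label //; lia.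
Qed.

End InvariantSubsets.

(** * Comparison of the two polynomials *)

(** Only finiteness turns the sums over these partitions into sums over
    sequences, with which evaluation and [tofrac] commute. *)
Lemma finite_Dset (m n l : nat) : (0 < m)%N -> (0 < n)%N -> (l < m * n)%N ->
  finite_set (Dset m n l).
Proof.
move=> m_gt0 n_gt0 l_lt.
pose G (b : n.-bseq 'I_m) := ([seq val i | i <- b], tau m n l).
apply: (@sub_finite_set _ _ (G @` setT)); last exact/finite_image/finite_finset.
move=> [s u] [/= s_part uE s_tau]; rewrite uE in s_tau *.
have entry_lt i : (i < size s)%N -> (nth 0%N s i < m)%N && (i < n)%N.
  move=> i_lt; have row_gt0 : (0 < row_len s i.+1)%N.
    rewrite lt0n; apply/negP => /eqP row0; case/andP: s_part => _.
    by rewrite -row0 mem_nth.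
  have fit := boxes_fit s_tau row_gt0 (ltn0Sn i) (leqnn _).
  apply/andP; split.
    by rewrite -(ltn_pmul2l n_gt0) -/(row_len s i.+1); lia.
  by rewrite -(ltn_pmul2l m_gt0); lia.
have size_s : (size (pmap insub s : seq 'I_m) <= n)%N.
  rewrite size_pmap; apply: leq_trans (count_size _ _) _.
  by rewrite leqNgt; apply/negP => /entry_lt; rewrite ltnn andbF.
exists (Bseq size_s) => //; congr (_, _); rewrite /= pmap_filter; last first.
  by move=> i; case: insubP.
apply/all_filterP/allP => _ /(nthP 0%N)[i /entry_lt /andP[i_lt _] <-].
by rewrite insubT.
Qed.

Lemma delta_bij (m n l : nat) : (0 < m)%N -> (0 < n)%N -> coprime m n ->
  (l < m * n)%N ->
  set_bij (Dset m n l) (InvW (wvec m n l)) (fun p => delta m n l p.1).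
Proof.
move=> m_gt0 n_gt0 mn_coprime l_lt; split.
- by move=> [s u] [/= s_part uE s_tau]; rewrite uE in s_tau; apply: delta_InvW.
- move=> [s u] [s' u']; rewrite !inE.
  move=> -[/= s_part uE s_tau] [/= s'_part u'E s'_tau].
  by rewrite uE u'E in s_tau s'_tau * => /delta_inj ->.
- move=> D /(delta_surj m_gt0 n_gt0 mn_coprime l_lt)[s [s_part s_tau <-]].
  by exists (s, tau m n l).
Qed.

Lemma horner0_fsprod (R : comNzRingType) (T : choiceType) (A : set T)
    (c : T -> R) : (\big[*%R/1]_(k \in A) (1 + c k *: 'X)).[0] = 1.
Proof.
rewrite horner_prod big1 // => k _.
by rewrite hornerD hornerC hornerZ hornerX mulr0 addr0.
Qed.

Theorem theorem2 (m n l : nat) :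
  (0 < m)%N -> (0 < n)%N -> coprime m n -> (0 < l < m * n)%N ->
  (schroder m n l).[0] = tofrac (catalan m n l).
Proof.
move=> m_gt0 n_gt0 mn_coprime /andP[_ l_lt].
have fin := finite_Dset m_gt0 n_gt0 l_lt.
rewrite /schroder /catalan.
rewrite (@reindex_fsbig _ _ _ _ _ _ (Dset m n l) _ _
  (delta_bij m_gt0 n_gt0 mn_coprime l_lt)).
rewrite !fsbig_finite // hornerZ horner_sum mulr_sumr rmorph_sum.
apply: eq_big_seq => -[s u]; rewrite in_fset_set // inE.
move=> -[/= s_part uE s_tau].
rewrite uE in s_tau *.
rewrite hornerZ horner0_fsprod mulr1 mulrCA area_delta //.
rewrite rmorphM !rmorphXn /=; congr (_ * _).
have := codinv'_dinv m_gt0 n_gt0 mn_coprime l_lt s_part s_tau.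
move=> /(canRL (addKr _)) dinvE.
rewrite !exprnP dinvE addrC expfzDr //.
by rewrite tofrac_eq0 polyX_eq0.
Qed.
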